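(* For all integers $m,n\ge 1$, the number $B_m^{(-n)}(3)$ of ternary strong lonesum $m\times n$ matrices equals $$1+\sum_{j=1}^{\min(m,n)}\ \sum_{\substack{(m_0,\ldots,m_j)\in\mathcal{S}_m^j\\ (n_0,\ldots,n_j)\in\mathcal{S}_n^j}}\binom{m}{m_0,m_1,\ldots,m_j}\binom{n}{n_0,n_1,\ldots,n_j}\prod_{i=1}^{j}f_3(m_i,n_{j+1-i}),$$ where $f_3(r,s)=1+rs+r(2^s-s-1)+s(2^r-r-1)$.
   Context: A ternary matrix has entries in $\{0,1,2\}$; a ternary $m\times n$ matrix is a strong lonesum matrix if no other ternary $m\times n$ matrix has the same row sums and column sums. For $j\ge 1$ and $l\ge 1$, $\mathcal{S}_l^j=\{(l_0,l_1,\ldots,l_j)\in\mathbb{Z}^{j+1}: \sum_{i=0}^j l_i=l,\ l_0\ge 0,\ l_i\ge 1 \text{ for } 1\le i\le j\}$. $\binom{l}{l_0,\ldots,l_j}=\frac{l!}{l_0!\cdots l_j!}$ is the multinomial coefficient. *)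

(* Defs.v *)
From mathcomp Require Import all_boot all_order all_algebra.
Set Implicit Arguments. Unset Strict Implicit. Unset Printing Implicit Defensive.

Definition ternary_mx (m n : nat) := 'M['I_3]_(m, n).

Definition row_sum m n (A : ternary_mx m n) (i : 'I_m) : nat :=
  \sum_(j < n) nat_of_ord (A i j).
Definition col_sum m n (A : ternary_mx m n) (j : 'I_n) : nat :=
  \sum_(i < m) nat_of_ord (A i j).

Definition strong_lonesum m n (A : ternary_mx m n) : bool :=
  [forall B : 'M['I_3]_(m, n),
    ([forall i, row_sum B i == row_sum A i] &&
     [forall j, col_sum B j == col_sum A j]) ==> (B == A)].

(* Membership of (l_0,...,l_j) (encoded as a function 'I_j.+1 -> 'I_l.+1,
   all entries being automatically <= l) in S_l^j. *)
Definition inS (l j : nat) (v : {ffun 'I_j.+1 -> 'I_l.+1}) : bool :=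
  (\sum_(i < j.+1) nat_of_ord (v i) == l) &&
  [forall i : 'I_j.+1, (0 < i)%N ==> (0 < v i)%N].

Definition multinom (l j : nat) (v : {ffun 'I_j.+1 -> 'I_l.+1}) : nat :=
  l`! %/ \prod_(i < j.+1) (nat_of_ord (v i))`!.

Definition f3 (r s : nat) : nat :=
  1 + r * s + r * (2 ^ s - s - 1) + s * (2 ^ r - r - 1).

(* Main.v *)
Require Import Defs.
From mathcomp Require Import all_boot all_order all_algebra.
From mathcomp Require Import zify.
Set Implicit Arguments. Unset Strict Implicit. Unset Printing Implicit Defensive.

(* A strong lonesum matrix contains no 2x2 configuration in which 1 can be added
   on one diagonal and subtracted on the other.  Hence the row supports form a
   chain; let j be the number of distinct nonempty ones.  Numbering rows and
   columns by the classes c and d in {0..j} that they get from this chain, an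
   entry is nonzero iff c + d > j, equals 2 if c + d > j + 1, and in each block
   c = i, d = j + 1 - i the 1s lie on a single line.  Conversely such a matrix is
   the only one with its margins, by maximality for the weights c + d - (j + 1)
   off the antidiagonal blocks and by a direct argument inside them.  As j, c and
   d are determined by the matrix, it remains to count: f3 r s is the number of
   subsets of an r x s grid contained in a line, and the number of maps c (or d)
   with given fibre sizes is a multinomial coefficient. *)

(** * Maps with prescribed fibre sizes *)

Definition ffun_cons (K : finType) m (p : K * {ffun 'I_m -> K}) :
    {ffun 'I_m.+1 -> K} :=
  [ffun x => oapp p.2 p.1 (unlift ord0 x)].

Lemma ffun_cons_bij (K : finType) m : bijective (@ffun_cons K m).
Proof.
exists (fun c : {ffun 'I_m.+1 -> K} => (c ord0, [ffun x => c (lift ord0 x)])) => [[i c]|c] /=.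
  congr pair; first by rewrite ffunE unlift_none.
  by apply/ffunP => x; rewrite !ffunE liftK.
apply/ffunP => x; rewrite ffunE /=.
by case: unliftP => [y|] ->; rewrite /= ?ffunE.
Qed.

(** Induction on [m], splitting the maps by their value at [ord0]. The product form avoids division
    of naturals. *)
Lemma card_ffun_fibres (K : finType) m (v : K -> nat) :
  \sum_i v i = m ->
  #|[set c : {ffun 'I_m -> K} | [forall i, \sum_x (c x == i) == v i]]|
    * \prod_i (v i)`! = m`!.
Proof.
elim: m v => [|m IHm] v sum_v.
  have v0 i : v i = 0 by move/eqP: sum_v; rewrite sum_nat_eq0 => /forallP/(_ i)/eqP.
  rewrite big1 ?muln1 => [|i _]; last by rewrite v0.
  rewrite (_ : finset _ = setT) ?cardsT ?card_ffun ?card_ord //.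
  by apply/setP => c; rewrite !inE; apply/forallP => i; rewrite big_ord0 v0.
rewrite -sum1_card big_mkcond (reindex _ (onW_bij _ (ffun_cons_bij K m))) /=.
rewrite -(pair_big xpredT xpredT (fun i c =>
  if ffun_cons (i, c) \in _ then 1 else 0)) /= big_distrl /=.
(* The factor [m.+1] is written as the sum of the [v i], so that the maps with first value [i] have
   to account for exactly [v i * m!]. *)
rewrite factS -[X in X * m`!]sum_v big_distrl /=; apply: eq_bigr => i _.
have sizes_cons c k : \sum_x (ffun_cons (i, c) x == k) = (i == k) + \sum_x (c x == k).
  rewrite big_ord_recl ffunE unlift_none; congr (_ + _).
  by apply: eq_bigr => x _; rewrite ffunE liftK.
have [vi0 | vi_gt0] := posnP (v i).
  rewrite vi0 mul0n big1 ?mul0n // => c _; rewrite inE.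
  case: forallP => // /(_ i); rewrite sizes_cons eqxx vi0; lia.
(* The fibre sizes left for the remaining [m] points once the first one has been sent to [i]. *)
pose w k := v k - (i == k).
have vw k : v k = (i == k) + w k by rewrite /w; case: eqP => [<-|_]; lia.
have sum_w : \sum_k w k = m.
  have : \sum_k v k = \sum_k (i == k) + \sum_k w k.
    by rewrite -big_split; apply: eq_bigr => k _; exact: vw.
  rewrite sum_v (bigD1 i) //= eqxx big1 => [|k /negPf]; last by rewrite eq_sym => ->.
  lia.
have -> : \prod_k (v k)`! = v i * \prod_k (w k)`!.
  rewrite (bigD1 i) //= [in RHS](bigD1 i) //= mulnA; congr (_ * _).
    by rewrite /w eqxx subn1; case: (v i) vi_gt0.
  by apply: eq_bigr => k /negPf; rewrite /w eq_sym => ->; rewrite subn0.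
rewrite -(IHm w sum_w) mulnCA; congr (_ * (_ * _)).
rewrite -sum1_card [RHS]big_mkcond /=; apply: eq_bigr => c _.
rewrite !inE; congr (if _ then _ else _); apply: eq_forallb => k.
by rewrite sizes_cons vw eqn_add2l.
Qed.

(** * Subsets of a grid contained in a line *)

(** Comparing pairs is enough: if two distinct points agree in one coordinate, a third point off
    their line would have to agree with both in the other coordinate, making them equal. *)
Definition collinear (T1 T2 : finType) (E : {set T1 * T2}) : bool :=
  [forall p in E, forall q in E, (p.1 == q.1) || (p.2 == q.2)].

Lemma collinearP (T1 T2 : finType) (E : {set T1 * T2}) :
  reflect {in E &, forall p q, p.1 = q.1 \/ p.2 = q.2} (collinear E).
Proof.
apply: (iffP forall_inP) => [colE p q pE qE | colE p pE].
  by case/orP: (forall_inP (colE p pE) q qE) => /eqP; [left | right].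
by apply/forall_inP => q qE; apply/orP; case: (colE p q pE qE) => ->; [left|right].
Qed.

Lemma card_subsets_gt1 (T : finType) (Y : {set T}) :
  #|[set S in powerset Y | 1 < #|S|]| = 2 ^ #|Y| - #|Y| - 1.
Proof.
have le1 : #|powerset Y :\: [set S : {set T} | 1 < #|S|]| = #|Y|.+1.
  rewrite -[#|Y|]bin1 -(cards_draws Y 1).
  rewrite (_ : _ :\: _ = set0 |: [set S : {set T} | S \subset Y & #|S| == 1]).
    by rewrite cardsU1 inE cards0 andbF.
  apply/setP => S; rewrite !inE; have [->|] := eqVneq S set0.
    by rewrite sub0set cards0.
  by rewrite -card_gt0; case: #|S| => [|[|k]] //= _; rewrite andbC.
have := cardsID [set S : {set T} | 1 < #|S|] (powerset Y).
by rewrite card_powerset le1 -setIdE; lia.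
Qed.

Lemma setX_inj (T1 T2 : finType) (A A' : {set T1}) (B B' : {set T2}) :
  A != set0 -> B != set0 -> setX A B = setX A' B' -> A = A' /\ B = B'.
Proof.
move=> /set0Pn[a aA] /set0Pn[b bB] eqX.
have mem x y : (x \in A) && (y \in B) = (x \in A') && (y \in B').
  by have := congr1 (fun E : {set _} => (x, y) \in E) eqX; rewrite !inE.
have /andP[aA' bB'] : (a \in A') && (b \in B') by rewrite -mem aA bB.
split; apply/setP => z.
  by have := mem z b; rewrite bB bB' !andbT.
by have := mem a z; rewrite aA aA'.
Qed.

(** The four terms of [f3] count disjoint families: the empty set, the singletons, and the sets of
    at least two points on a line with fixed first, respectively second, coordinate. *)
Lemma card_collinear (T1 T2 : finType) (X : {set T1}) (Y : {set T2}) :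
  #|[set E in powerset (setX X Y) | collinear E]| = f3 #|X| #|Y|.
Proof.
pose P (T : finType) (Z : {set T}) := [set S in powerset Z | 1 < #|S|].
pose S1 := [set [set p] | p in setX X Y].
pose S2 := [set setX [set q.1] q.2 | q in setX X (P _ Y)].
pose S3 := [set setX q.2 [set q.1] | q in setX Y (P _ X)].
have set1n0 (T : finType) (x : T) : [set x] != set0.
  by apply/set0Pn; exists x; rewrite inE.
have Pn0 (T : finType) (Z S : {set T}) : S \in P _ Z -> S != set0.
  by rewrite !inE -card_gt0 => /andP[_ /ltnW].
have cS1 : #|S1| = #|X| * #|Y| by rewrite card_imset ?cardsX //; exact: set1_inj.
have cS2 : #|S2| = #|X| * (2 ^ #|Y| - #|Y| - 1).
  rewrite card_in_imset ?cardsX ?card_subsets_gt1 //.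
  move=> [x S] [x' S'] /setXP[_ /Pn0 S0] _ /=.
  by case/(setX_inj (set1n0 _ _) S0) => /set1_inj -> ->.
have cS3 : #|S3| = #|Y| * (2 ^ #|X| - #|X| - 1).
  rewrite card_in_imset ?cardsX ?card_subsets_gt1 //.
  move=> [x S] [x' S'] /setXP[_ /Pn0 S0] _ /=.
  by case/(setX_inj S0 (set1n0 _ _)) => -> /set1_inj ->.
have cardS1 E : E \in S1 -> #|E| = 1 by case/imsetP => p _ ->; rewrite cards1.
have cardS2 E : E \in S2 -> 1 < #|E|.
  by case/imsetP => -[a S] /setXP[_]; rewrite !inE => /andP[_ gt1] ->; rewrite cardsX cards1 mul1n.
have cardS3 E : E \in S3 -> 1 < #|E|.
  by case/imsetP => -[a S] /setXP[_]; rewrite !inE => /andP[_ gt1] ->; rewrite cardsX cards1 muln1.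
have -> : [set E in powerset (setX X Y) | collinear E] = set0 |: (S1 :|: (S2 :|: S3)).
  apply/setP => E; rewrite 6!inE; apply/andP/idP.
    case => sE /collinearP colE.
    case: eqP => //= /eqP /set0Pn[p pE].
    have pXY := subsetP sE p pE.
    have /andP[pX pY] : (p.1 \in X) && (p.2 \in Y) by rewrite -in_setX -surjective_pairing.
    have [-> | ] := eqVneq E [set p]; first by rewrite imset_f.
    rewrite eq_sym eqEproper sub1set pE /= negbK => /properP[_ [q qE]].
    rewrite inE => qp.
    have gt1 : 1 < #|E| by apply/card_gt1P; exists p, q; rewrite eq_sym.
    apply/orP; right; apply/orP.
    have [eq1 | eq2] := colE _ _ pE qE.
      have neq2 : p.2 <> q.2.
        by move=> eq2; case/eqP: qp; case: (p) (q) eq1 eq2 => ? ? [? ?] /= -> ->.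
      have all1 r : r \in E -> r.1 = p.1.
        move=> rE; case: (colE _ _ rE pE) => // r2.
        by case: (colE _ _ rE qE) => [-> // | r2']; case: neq2; rewrite -r2.
      have defE : E = setX [set p.1] (snd @: E).
        apply/setP => -[a b]; rewrite !inE /=; apply/idP/andP => [abE | [/eqP -> /imsetP[r rE ->]]].
          split; [by rewrite -(all1 _ abE) | exact: (imset_f snd abE)].
        by rewrite -(all1 _ rE); case: (r) rE.
      left; apply/imsetP; exists (p.1, snd @: E) => //.
      rewrite !inE /= pX /=; apply/andP; split.
        by apply/subsetP => _ /imsetP[[a b] abE ->]; have /setXP[] := subsetP sE _ abE.
      by move: gt1; rewrite {1}defE cardsX cards1 mul1n.
    have neq1 : p.1 <> q.1.
      by move=> eq1; case/eqP: qp; case: (p) (q) eq1 eq2 => ? ? [? ?] /= -> ->.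
    have all2 r : r \in E -> r.2 = p.2.
      move=> rE; case: (colE _ _ rE pE) => // r1.
      by case: (colE _ _ rE qE) => [r1' | -> //]; case: neq1; rewrite -r1.
    have defE : E = setX (fst @: E) [set p.2].
      apply/setP => -[a b]; rewrite !inE /=; apply/idP/andP => [abE | [/imsetP[r rE ->] /eqP ->]].
        split; [exact: (imset_f fst abE) | by rewrite -(all2 _ abE)].
      by rewrite -(all2 _ rE); case: (r) rE.
    right; apply/imsetP; exists (p.2, fst @: E) => //.
    rewrite !inE /= pY /=; apply/andP; split.
      by apply/subsetP => _ /imsetP[[a b] abE ->]; have /setXP[] := subsetP sE _ abE.
    by move: gt1; rewrite {1}defE cardsX cards1 muln1.
  case/or4P => [/eqP -> | /imsetP[p pXY ->] | /imsetP[[a S] /setXP[qX]] | /imsetP[[a S] /setXP[qY]]].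
  - by rewrite sub0set; split=> //; apply/collinearP => p q; rewrite inE.
  - rewrite sub1set; split=> //.
    by apply/collinearP => r s; rewrite !inE => /eqP -> /eqP ->; left.
  - rewrite !inE => /andP[sS _] ->; split.
      by apply: setXS; rewrite ?sub1set.
    by apply/collinearP => -[? ?] [? ?] /setXP[/set1P -> _] /setXP[/set1P -> _]; left.
  rewrite !inE => /andP[sS _] ->; split.
    by apply: setXS; rewrite ?sub1set.
  by apply/collinearP => -[? ?] [? ?] /setXP[_ /set1P ->] /setXP[_ /set1P ->]; right.
rewrite cardsU1 cardsU cardsU cS1 cS2 cS3 /f3.
have -> : set0 \notin S1 :|: (S2 :|: S3).
  by rewrite !inE; apply/negP => /or3P[/cardS1|/cardS2|/cardS3]; rewrite cards0.
have -> : S1 :&: (S2 :|: S3) = set0.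
  apply/setP => E; rewrite !inE; apply/negP => /andP[/cardS1 E1].
  by case/orP => [/cardS2|/cardS3]; rewrite E1.
have -> : S2 :&: S3 = set0; last by rewrite !cards0; lia.
apply/setP => E; rewrite !inE; apply/negP => /andP[ES2 ES3].
have /card_gt1P[[p1 p2] [[q1 q2] [pE qE]]] := cardS2 _ ES2.
have [[a S] _ /= defE] := imsetP ES2; have [[b S'] _ /= defE'] := imsetP ES3.
move: (pE) (qE); rewrite {1 2}defE => /setXP[/set1P -> _] /setXP[/set1P -> _].
by move: pE qE; rewrite defE' => /setXP[_ /set1P ->] /setXP[_ /set1P ->] /eqP.
Qed.

(** * Matrices determined by their margins, and forbidden switches *)

Definition same_margins m n (A B : ternary_mx m n) : Prop :=
  (forall x, row_sum B x = row_sum A x) /\ (forall y, col_sum B y = col_sum A y).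

Lemma strong_lonesumP m n (A : ternary_mx m n) :
  reflect (forall B, same_margins A B -> B = A) (strong_lonesum A).
Proof.
apply: (iffP forallP) => [lA B [rB cB] | lA B].
  apply/eqP; apply: (implyP (lA B)); apply/andP; split; apply/forallP => ?; exact/eqP.
apply/implyP => /andP[/forallP rB /forallP cB]; apply/eqP/lA.
by split=> ?; apply/eqP.
Qed.

Lemma row_sum_tr m n (A : ternary_mx m n) y : row_sum A^T%R y = col_sum A y.
Proof. by apply: eq_bigr => x _; rewrite mxE. Qed.

Lemma col_sum_tr m n (A : ternary_mx m n) x : col_sum A^T%R x = row_sum A x.
Proof. by apply: eq_bigr => y _; rewrite mxE. Qed.

Lemma same_margins_tr m n (A B : ternary_mx m n) :
  same_margins A B -> same_margins A^T%R B^T%R.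
Proof. by case=> rB cB; split=> i; rewrite ?row_sum_tr ?col_sum_tr. Qed.

Lemma eq_of_leq_sum (I : finType) (F G : I -> nat) :
  (forall i, F i <= G i) -> \sum_i F i = \sum_i G i -> F =1 G.
Proof.
move=> leFG eqFG i; apply/eqP; have := leqif_sum (fun i (_ : true) => leqif_eq (leFG i)).
by case=> _; rewrite eqFG eqxx => /esym/forallP/(_ i)/eqP ->.
Qed.

(* Row classes [c] and column classes [d] are numbered from 0 to [j]; the
   entries are 0 below the antidiagonal [c + d = j + 1], 2 above it, and an
   antidiagonal block consists of 2s except for 1s lying on a single line. *)
Record block_shape m n j (c : 'I_m -> nat) (d : 'I_n -> nat) (A : ternary_mx m n) : Prop :=
  BlockShape {
    shape0 : forall x y, c x + d y <= j -> A x y = 0 :> nat;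
    shape1 : forall x y, c x + d y = j.+1 -> 0 < A x y;
    shape2 : forall x y, j.+1 < c x + d y -> A x y = 2 :> nat;
    shape_line : forall x x' y y', c x + d y = j.+1 -> c x' = c x -> d y' = d y ->
      A x y = 1 :> nat -> A x' y' = 1 :> nat -> x = x' \/ y = y'
  }.

Lemma shape_tr m n j (c : 'I_m -> nat) (d : 'I_n -> nat) A :
  block_shape j c d A -> block_shape j d c A^T%R.
Proof.
case=> s0 s1 s2 sl; split=> [y x|y x|y x|y y' x x']; rewrite ?mxE addnC; auto.
by move=> cd ey ex A1 A2; case: (sl x x' y y' cd ex ey A1 A2); auto.
Qed.

Section ShapeLonesum.
Variables (m n j : nat) (c : 'I_m -> nat) (d : 'I_n -> nat) (A B : ternary_mx m n).
Hypotheses (shA : block_shape j c d A) (AB : same_margins A B).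

(* [A] maximises the linear functional with coefficients [c x + d y - j.+1],
   whose value depends on the margins only. *)
Lemma shape_margins_off x y : c x + d y != j.+1 -> B x y = A x y.
Proof.
move=> off; case: AB => rB cB.
have weighted (M : ternary_mx m n) :
    \sum_(p : 'I_m * 'I_n) (c p.1 + d p.2) * M p.1 p.2 =
    \sum_x c x * row_sum M x + \sum_y d y * col_sum M y.
  rewrite -(pair_big xpredT xpredT (fun x y => (c x + d y) * M x y)) /=.
  under [\sum_y _ * col_sum _ _]eq_bigr => y' _ do rewrite big_distrr /=.
  rewrite [X in _ = _ + X]exchange_big -big_split /=; apply: eq_bigr => x' _.
  by rewrite big_distrr -big_split; apply: eq_bigr => y' _ /=; rewrite mulnDl.
have total (M : ternary_mx m n) :
    \sum_(p : 'I_m * 'I_n) j.+1 * M p.1 p.2 = \sum_x j.+1 * row_sum M x.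
  rewrite -(pair_big xpredT xpredT (fun x y => j.+1 * M x y)) /=.
  by apply: eq_bigr => x' _; rewrite big_distrr.
(* [F p <= G p] says that [c + d - j.+1] times [B - A] is at most 0, with the negative terms moved
   across to stay within the naturals. Off the antidiagonal, equality forces [B = A]. *)
pose F (p : 'I_m * 'I_n) := (c p.1 + d p.2) * B p.1 p.2 + j.+1 * A p.1 p.2.
pose G (p : 'I_m * 'I_n) := (c p.1 + d p.2) * A p.1 p.2 + j.+1 * B p.1 p.2.
have leB x' y' : B x' y' <= 2 by rewrite -ltnS.
have leFG p : F p <= G p.
  case: p => x' y'; rewrite /F /G /=.
  have [lt_cd | gt_cd | ->] := ltngtP (c x' + d y') j.+1.
  - by rewrite (shape0 shA lt_cd); nia.
  - by rewrite (shape2 shA gt_cd); have := leB x' y'; nia.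
  - by rewrite addnC.
have eqFG : \sum_p F p = \sum_p G p.
  rewrite [LHS]big_split [RHS]big_split /= !weighted !total.
  under [\sum_x c x * row_sum B x]eq_bigr => x' _ do rewrite rB.
  under [\sum_y d y * col_sum B y]eq_bigr => y' _ do rewrite cB.
  by under [\sum_x _ * row_sum B x]eq_bigr => x' _ do rewrite rB.
have := eq_of_leq_sum leFG eqFG (x, y); rewrite /F /G /= => eqAB.
apply/val_inj => /=; nia.
Qed.

(** Without 1s, the entries of [A] in this row of the block are all 2, the maximum. Elsewhere in the
    row [B] and [A] agree, so [B <= A] along the whole row and the equal row sums force equality. *)
Lemma shape_margins_row_free x y :
  c x + d y = j.+1 -> (forall y', d y' = d y -> A x y' <> 1 :> nat) -> B x y = A x y.
Proof.
move=> cd free; apply/val_inj.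
have leB x' y' : B x' y' <= 2 by rewrite -ltnS.
apply: (@eq_of_leq_sum _ (fun y => B x y : nat) (fun y => A x y : nat)); last first.
  by case: AB => rB _; have := rB x.
move=> y' /=; have [cd' | off] := eqVneq (c x + d y') j.+1; last by rewrite shape_margins_off.
have := shape1 shA cd'; have := free y'; have := leB x y'; lia.
Qed.

End ShapeLonesum.

(** Another row [x'] of the block cannot contain a 1 there: by the line condition that 1 would be in
    column [y], against the hypothesis. So all other entries of column [y] are already known to
    agree, and the column sum gives the last one. *)
Lemma shape_margins_col_single m n j (c : 'I_m -> nat) (d : 'I_n -> nat) A B x y :
  block_shape j c d A -> same_margins A B -> c x + d y = j.+1 -> A x y = 1 :> nat ->
  (forall x', c x' = c x -> A x' y = 1 :> nat -> x' = x) -> B x y = A x y.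
Proof.
move=> shA AB cd A1 single.
have others x' : x' != x -> B x' y = A x' y.
  move=> x'x; have [cd' | off] := eqVneq (c x' + d y) j.+1; last by apply: (shape_margins_off shA AB).
  apply: (shape_margins_row_free shA AB cd') => y' dy' A1'.
  have ecx : c x = c x' by lia.
  have [ex | ey] := shape_line shA (etrans (congr1 _ dy') cd') ecx (esym dy') A1' A1.
    by rewrite ex eqxx in x'x.
  by move/eqP: x'x; apply; apply: single; rewrite // -ey.
apply/val_inj; case: AB => _ /(_ y); rewrite /col_sum (bigD1 x) //= [in RHS](bigD1 x) //=.
by under eq_bigr => x' x'x do rewrite others //; move/addIn.
Qed.

Lemma shape_strong_lonesum m n j (c : 'I_m -> nat) (d : 'I_n -> nat) A :
  block_shape j c d A -> strong_lonesum A.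
Proof.
move=> shA; apply/strong_lonesumP => B AB; apply/matrixP => x y.
have shT := shape_tr shA; have ABT := same_margins_tr AB.
have [cd | off] := eqVneq (c x + d y) j.+1; last by apply: (shape_margins_off shA AB).
have dc : d y + c x = j.+1 by rewrite addnC.
(* If the row or the column of the position has no 1 within its block, the row-free lemma or its
   transpose applies. Otherwise the line condition puts a 1 at the position itself. *)
have [/existsP[y1 /andP[/eqP dy1 /eqP A1]] | row_free] :=
  boolP [exists y', (d y' == d y) && (A x y' == 1 :> nat)]; last first.
  apply: (shape_margins_row_free shA AB cd) => y' dy' A1.
  by move/existsP: row_free; apply; exists y'; rewrite dy' A1 !eqxx.
have [/existsP[x1 /andP[/eqP cx1 /eqP A2]] | col_free] :=
  boolP [exists x', (c x' == c x) && (A x' y == 1 :> nat)]; last first.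
  have := shape_margins_row_free shT ABT dc; rewrite !mxE; apply => x' cx'; rewrite mxE => A2.
  by move/existsP: col_free; apply; exists x'; rewrite cx' A2 !eqxx.
have Axy : A x y = 1 :> nat.
  have [-> // | <- //] := shape_line shA (etrans (congr1 _ dy1) cd) cx1 (esym dy1) A1 A2.
(* A second 1 in column [y] makes that column the line of the block, so the 1 at the position is
   alone in its row and the transposed lemma applies. *)
have [/existsP[x2 /and3P[/eqP cx2 /eqP A3 x2x]] | single] :=
  boolP [exists x', [&& c x' == c x, A x' y == 1 :> nat & x' != x]]; last first.
  apply: (shape_margins_col_single shA AB cd Axy) => x' cx' A3; apply/eqP.
  by apply: contraNT single => x'x; apply/existsP; exists x'; rewrite cx' A3 !eqxx.
have := shape_margins_col_single shT ABT dc; rewrite !mxE; apply=> // y' dy'; rewrite mxE => A4.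
have [xx | -> //] := shape_line shA (etrans (congr1 _ dy') cd) cx2 (esym dy') A4 A3.
by rewrite xx eqxx in x2x.
Qed.

(* In an alternating 2x2 configuration one can add 1 on the diagonal and
   subtract 1 off it. *)
Lemma strong_lonesum_no_switch m n (A : ternary_mx m n) x x' y y' :
  strong_lonesum A -> x != x' -> y != y' ->
  A x y <= 1 -> A x' y' <= 1 -> 0 < A x y' -> 0 < A x' y -> False.
Proof.
move=> /strong_lonesumP lA xx' yy' Axy Ax'y' Axy' Ax'y.
pose up i k := ((i == x) && (k == y)) + ((i == x') && (k == y')).
pose down i k := ((i == x) && (k == y')) + ((i == x') && (k == y)).
pose B : ternary_mx m n := (\matrix_(i, k) inord (A i k + up i k - down i k))%R.
have BA i k : B i k + down i k = A i k + up i k.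
  (* These bounds make the truncated subtraction and [inord] in [B] exact. *)
  have ud : down i k <= A i k + up i k <= 2 + down i k.
    have : A i k <= 2 by rewrite -ltnS.
    rewrite /down /up.
    case: (eqVneq i x) => [->|_]; [rewrite (negPf xx') | case: (eqVneq i x') => [->|_]];
      (case: (eqVneq k y) => [->|_]; [rewrite (negPf yy') | case: (eqVneq k y') => [->|_]]);
      rewrite /=; lia.
  rewrite mxE inordK; lia.
have sum_pt (I : finType) (a : I) (b : bool) : \sum_i (b && (i == a)) = b.
  by rewrite (bigD1 a) //= eqxx andbT big1 ?addn0 // => i /negPf ->; rewrite andbF.
have sum_pt' (I : finType) (a : I) (b : bool) : \sum_i ((i == a) && b) = b.
  by under eq_bigr => i _ do rewrite andbC; exact: sum_pt.
have margB : same_margins A B.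
  split=> [i | k].
    have : \sum_k (B i k + down i k) = \sum_k (A i k + up i k) by apply: eq_bigr.
    by rewrite !big_split /= !sum_pt => /addIn.
  have : \sum_i (B i k + down i k) = \sum_i (A i k + up i k) by apply: eq_bigr.
  by rewrite !big_split /= !sum_pt' [in X in _ = _ + X]addnC => /addIn.
have := BA x y; rewrite (lA B margB) /up /down !eqxx (negPf xx') (negPf yy') /=; lia.
Qed.

(** Class 0, that of the zero rows or columns, may be empty, just as [inS] lets the entry at index 0
    vanish. *)
Definition hits_all (T : Type) j (c : T -> nat) : Prop :=
  forall k, 0 < k <= j -> exists x, c x = k.

Lemma in_setId (T : finType) (A : {set T}) (P : pred T) x :
  (x \in [set y in A | P y]) = (x \in A) && P x.
Proof. by rewrite inE. Qed.

(** * Classes read off the chain of row supports *)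

Section Levels.
Variables (m n : nat) (A : ternary_mx m n).

Definition row_supp (x : 'I_m) : {set 'I_n} := [set y | 0 < A x y].
Definition levels : {set {set 'I_n}} := [set row_supp x | x in 'I_m] :\ set0.
(** When the supports are nested, this is the position of the support of row [x] in the chain of
    levels, with 0 for a zero row. *)
Definition row_class (x : 'I_m) : nat := #|[set S in levels | S \subset row_supp x]|.
Definition col_class (y : 'I_n) : nat := #|[set S in levels | y \in S]|.

Lemma row_class_le x : row_class x <= #|levels|.
Proof. by rewrite subset_leq_card // setIdE subsetIl. Qed.

Lemma col_class_le y : col_class y <= #|levels|.
Proof. by rewrite subset_leq_card // setIdE subsetIl. Qed.

Lemma row_supp_level x y : 0 < A x y -> row_supp x \in levels.
Proof.
by move=> Axy; rewrite !inE imset_f // andbT; apply/set0Pn; exists y; rewrite inE.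
Qed.

Hypothesis nested : forall x x', (row_supp x \subset row_supp x') || (row_supp x' \subset row_supp x).

Lemma levels_nested S S' : S \in levels -> S' \in levels -> (S \subset S') || (S' \subset S).
Proof. by rewrite !inE => /andP[_ /imsetP[x _ ->]] /andP[_ /imsetP[x' _ ->]]. Qed.

(** The sum of the classes is the size of the union plus that of the intersection of two sets of
    levels: those inside the support of [x] and those containing [y]. If the entry is nonzero, the
    union is everything and the support of [x] is in the intersection; otherwise the intersection is
    empty. *)
Lemma nested_stair x y : (#|levels| < row_class x + col_class y) = (0 < A x y).
Proof.
rewrite /row_class /col_class -cardsUI; have [Axy | Axy] := boolP (0 < A x y).
  set U := _ :|: _; set I := _ :&: _.
  have -> : U = levels.
    apply/setP => S; rewrite in_setU !in_setId -andb_orr andb_idr // => Slev.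
    case/orP: (levels_nested Slev (row_supp_level Axy)) => [-> // | sub].
    by rewrite (subsetP sub) ?inE ?orbT.
  rewrite -[X in X < _]addn0 ltn_add2l card_gt0; apply/set0Pn.
  by exists (row_supp x); rewrite in_setI !in_setId (row_supp_level Axy) subxx inE.
set U := _ :|: _; set I := _ :&: _.
have -> : I = set0.
  apply/setP => S; rewrite in_setI !in_setId [RHS]in_set0; apply/negP => /andP[/andP[_ /subsetP sub]].
  by case/andP => _ /sub; rewrite inE (negPf Axy).
rewrite cards0 addn0; apply/negbTE; rewrite -leqNgt subset_leq_card //.
by rewrite /U !setIdE -setIUr subsetIl.
Qed.

Lemma row_class_subset x x' : row_class x <= row_class x' -> row_supp x \subset row_supp x'.
Proof.
move=> le_xx'; case/orP: (nested x x') => // sub.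
have [-> | /set0Pn[y]] := eqVneq (row_supp x) set0; first exact: sub0set.
rewrite inE => /row_supp_level lev.
have : [set S in levels | S \subset row_supp x'] == [set S in levels | S \subset row_supp x].
  rewrite eqEcard le_xx' andbT; apply/subsetP => S; rewrite [in _ \in _]inE => /andP[SL Sx'].
  by rewrite inE SL (subset_trans Sx').
move/eqP/setP/(_ (row_supp x)); by rewrite [RHS]inE lev subxx inE lev.
Qed.

(** The rank is injective and nonzero on the levels, so by counting it takes every value from 1 to
    [#|levels|]. *)
Lemma row_class_hits : hits_all #|levels| row_class.
Proof.
move=> k /andP[k_gt0 k_le].
pose rk (S : {set 'I_n}) : 'I_#|levels|.+1 := inord #|[set S' in levels | S' \subset S]|.
have rkE x : rk (row_supp x) = row_class x :> nat by rewrite inordK // ltnS row_class_le.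
have rk_inj : {in levels &, injective rk}.
  move=> S S'; rewrite inE => /andP[_ /imsetP[x _ ->]]; rewrite inE => /andP[_ /imsetP[x' _ ->]].
  move/(congr1 (@nat_of_ord _)); rewrite !rkE => eq_cl.
  by apply/eqP; rewrite eqEsubset !row_class_subset ?eq_cl.
have im_rk : rk @: levels = [set~ ord0].
  apply/eqP; rewrite eqEcard cardsC1 card_ord card_in_imset // leqnn andbT.
  apply/subsetP => _ /imsetP[S Slev ->]; rewrite !inE -val_eqE /=.
  move: (Slev); rewrite 2!inE => /andP[_ /imsetP[x _ defS]].
  rewrite defS rkE -lt0n card_gt0; apply/set0Pn; exists S.
  by rewrite inE Slev defS subxx.
have : inord k \in rk @: levels.
  by rewrite im_rk !inE -val_eqE /= inordK // -lt0n.
case/imsetP => S; rewrite 2!inE => /andP[_ /imsetP[x _ ->]] /(congr1 (@nat_of_ord _)).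
by rewrite rkE inordK //; exists x.
Qed.

Lemma col_class_hits : hits_all #|levels| col_class.
Proof.
move=> k k_rank; have [x cx] : exists x, row_class x = #|levels|.+1 - k.
  by apply: row_class_hits; lia.
(* [U] stands for the support of a row one class below [x]. The numerical definition also covers
   class 1, where [U] is empty. A column in the support of [x] but outside [U] has class exactly
   [k]. *)
pose U := [set y | #|levels| < (row_class x).-1 + col_class y].
have ex_y : exists2 y, 0 < A x y & y \notin U.
  have [cx1 | cx_gt1] := leqP (row_class x) 1.
    have : 0 < row_class x by lia.
    rewrite card_gt0 => /set0Pn[S]; rewrite 3!inE => /andP[/andP[Sn0 _] /subsetP sub].
    have /set0Pn[y yS] := Sn0; exists y; first by have := sub _ yS; rewrite inE.
    by rewrite inE -leqNgt; have := col_class_le y; lia.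
  have [x' cx'] : exists x', row_class x' = (row_class x).-1.
    by apply: row_class_hits; have := row_class_le x; lia.
  have : ~~ (row_supp x \subset row_supp x').
    apply: contraTN isT => sub; have : row_class x <= row_class x'; last by lia.
    apply/subset_leq_card/subsetP => S; rewrite inE => /andP[Slev Sx].
    by rewrite inE Slev (subset_trans Sx).
  case/subsetPn => y; rewrite !inE => yx yx'; exists y => //.
  by rewrite inE -cx' nested_stair.
case: ex_y => y; rewrite -nested_stair inE -leqNgt => lt_cd ge_cd; exists y; lia.
Qed.

End Levels.

(** Uniqueness of the classes: the staircase condition makes the support of a row of class [k.+1]
    equal to [S k], and the [S k] form a strictly increasing chain of [j] sets, which must be the
    chain of levels. *)
Lemma stair_classes m n (A : ternary_mx m n) j (c : 'I_m -> nat) (d : 'I_n -> nat) :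
  (forall x, c x <= j) -> (forall y, d y <= j) -> hits_all j c -> hits_all j d ->
  (forall x y, (j < c x + d y) = (0 < A x y)) ->
  [/\ #|levels A| = j, row_class A =1 c & col_class A =1 d].
Proof.
move=> cj dj hc hd stair.
pose S (k : 'I_j) := [set y | j < k.+1 + d y].
have S_sub k x : (S k \subset row_supp A x) = (k < c x).
  apply/subsetP/idP => [sub | k_lt y]; last by rewrite !inE -stair; lia.
  have [y dy] : exists y, d y = j - k by apply: hd; have := ltn_ord k; lia.
  by have := sub y; rewrite !inE -stair dy; have := ltn_ord k; lia.
have supp_S x (k : 'I_j) : c x = k.+1 -> row_supp A x = S k.
  by move=> cx; apply/setP => y; rewrite !inE -stair cx.
have S_le k k' : (S k \subset S k') = (k <= k').
  have [x cx] : exists x, c x = k'.+1 by apply: hc; rewrite ltn_ord.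
  by rewrite -(supp_S x k' cx) S_sub cx.
have S_inj : injective S.
  by move=> k k' eqS; apply/val_inj/eqP; rewrite eqn_leq -!S_le eqS subxx.
have lev : levels A = S @: setT.
  apply/setP => X; apply/idP/imsetP => [|[k _ ->]].
    rewrite 2!inE => /andP[Xn0 /imsetP[x _ defX]].
    have /set0Pn[y] := Xn0; rewrite defX inE -stair => lt_cd.
    have k_lt : (c x).-1 < j by have := cj x; have := dj y; lia.
    exists (Ordinal k_lt) => //; apply: supp_S => /=; have := dj y; lia.
  have [x cx] : exists x, c x = k.+1 by apply: hc; rewrite ltn_ord.
  have [y dy] : exists y, d y = j by apply: hd; have := ltn_ord k; lia.
  by rewrite -(supp_S x k cx); apply: (@row_supp_level _ _ _ _ y); rewrite -stair cx dy; lia.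
have card_lt k : k <= j -> #|[set i : 'I_j | i < k]| = k.
  move=> kj; rewrite -sum1_card -[RHS]card_ord -sum1_card (big_ord_widen_cond j xpredT (fun _ => 1) kj).
  by apply: eq_bigl => i; rewrite inE.
split=> [|x|y].
- by rewrite lev card_imset // cardsT card_ord.
- rewrite /row_class -[RHS]card_lt // -(card_imset _ S_inj); apply: eq_card => X.
  rewrite inE lev; apply/andP/imsetP => [[/imsetP[k _ ->]] | [k]].
    by rewrite S_sub => lt_k; exists k; rewrite ?inE.
  by rewrite inE => lt_k ->; rewrite S_sub imset_f ?inE.
(* Column [y] lies in [S k] iff [j - d y <= k]; the complement brings this to the form counted by
   [card_lt]. *)
have -> : col_class A y = #|S @: ~: [set i : 'I_j | i < j - d y]|.
  apply: eq_card => X; rewrite inE lev; apply/andP/imsetP => [[/imsetP[k _ ->]] | [k]].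
    by rewrite inE => lt_k; exists k; rewrite ?inE //; lia.
  by rewrite !inE => lt_k ->; rewrite imset_f ?inE //; split=> //; lia.
rewrite card_imset // cardsCs setCK card_ord card_lt; have := dj y; lia.
Qed.

(** Each point rests on a forbidden switch: incomparable row supports, a 1 above the antidiagonal,
    or two 1s of one block not on a line would each produce one. *)
Lemma strong_lonesum_shape m n (A : ternary_mx m n) :
  strong_lonesum A ->
  [/\ block_shape #|levels A| (row_class A) (col_class A) A,
      hits_all #|levels A| (row_class A) & hits_all #|levels A| (col_class A)].
Proof.
move=> lA; have noswitch := strong_lonesum_no_switch lA.
have nested x x' : (row_supp A x \subset row_supp A x') || (row_supp A x' \subset row_supp A x).
  apply: contraT; rewrite negb_or => /andP[/subsetPn[y]]; rewrite !inE => Axy Ax'y.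
  case/subsetPn => y'; rewrite !inE => Ax'y' Axy'.
  by case: (noswitch x x' y' y); rewrite // ?(leq_trans _ (leqnSn 0)) //;
     do ?[apply: contraNN Ax'y => /eqP <- | apply: contraNN Axy' => /eqP ->]; lia.
have stair := nested_stair nested.
have hc := row_class_hits nested; have hd := col_class_hits nested.
have le2 x y : A x y <= 2 by rewrite -ltnS.
split=> //; split=> [x y le_cd | x y eq_cd | x y lt_cd | x x' y y' eq_cd cx' dy' A1 A1'].
- by have := stair x y; lia.
- by rewrite -stair eq_cd.
- have Axy : 0 < A x y by rewrite -stair; lia.
  have := row_class_le A x; have := col_class_le A y => dj cj.
  (* The positions [(x', y)] and [(x, y')] are put on the antidiagonal, hence nonzero, which places
     [(x', y')] below it, hence zero. An entry at most 1 at [(x, y)] would then allow a switch. *)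
  have [x' cx'] : exists x', row_class A x' = #|levels A|.+1 - col_class A y by apply: hc; lia.
  have [y' dy'] : exists y', col_class A y' = #|levels A|.+1 - row_class A x by apply: hd; lia.
  have xx' : x != x' by apply: contraTN isT => /eqP ex; rewrite -ex in cx'; lia.
  have yy' : y != y' by apply: contraTN isT => /eqP ey; rewrite -ey in dy'; lia.
  have Ax'y : 0 < A x' y by rewrite -stair cx'; lia.
  have Axy' : 0 < A x y' by rewrite -stair dy'; lia.
  have Ax'y' : A x' y' <= 1 by have := stair x' y'; rewrite cx' dy'; lia.
  have := le2 x y; case: (leqP (A x y) 1) => [Axy1 _ | ]; last by lia.
  by case: (noswitch x x' y y').
have [-> | xx'] := eqVneq x x'; first by left.
have [-> | yy'] := eqVneq y y'; first by right.
have := stair x y'; have := stair x' y; rewrite cx' dy' eq_cd ltnSn => /esym A3 /esym A4.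
by case: (noswitch _ _ _ _ xx' yy'); rewrite ?A1 ?A1'.
Qed.

(** * Counting the matrices with given classes *)

(** The index [i] starts at 0 and stands for the block of row class [i.+1] and column class
    [j - i]. *)
Definition block_ones m n j (c : 'I_m -> nat) (d : 'I_n -> nat) (A : ternary_mx m n) :
    {ffun 'I_j -> {set 'I_m * 'I_n}} :=
  [ffun i : 'I_j => [set p | [&& c p.1 == i.+1, d p.2 == j - i & A p.1 p.2 == 1 :> nat]]].

Definition blocks_mx m n j (c : 'I_m -> nat) (d : 'I_n -> nat)
    (E : {ffun 'I_j -> {set 'I_m * 'I_n}}) : ternary_mx m n :=
  (\matrix_(x, y)
    if (c x + d y <= j)%N then inord 0
    else if [exists i : 'I_j, (x, y) \in E i] then inord 1 else inord 2)%R.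

(** For fixed [c] and [d], only the positions of the 1s in the antidiagonal blocks are free:
    [block_ones] is a bijection onto the families of collinear subsets of the blocks, with inverse
    [blocks_mx]. The set [G] is a parameter because [block_shape] is a proposition, not a Boolean
    predicate. *)
Lemma card_block_shape m n j (c : 'I_m -> nat) (d : 'I_n -> nat) (G : {set ternary_mx m n}) :
  (forall x, c x <= j) -> (forall y, d y <= j) ->
  (forall A, A \in G <-> block_shape j c d A) ->
  #|G| = \prod_(i < j) f3 #|[set x | c x == i.+1]| #|[set y | d y == j - i]|.
Proof.
move=> cj dj GP.
pose X (i : 'I_j) := [set x | c x == i.+1]; pose Y (i : 'I_j) := [set y | d y == j - i].
pose L i := [set E in powerset (setX (X i) (Y i)) | collinear E].
have ones_inj : {in G &, injective (block_ones j c d)}.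
  move=> A B /GP[A0 A1 A2 _] /GP[B0 B1 B2 _] eqAB; apply/matrixP => x y; apply/val_inj => /=.
  have [lt_cd | gt_cd | eq_cd] := ltngtP (c x + d y) j.+1.
  - by rewrite A0 // B0.
  - by rewrite A2 // B2.
  have i_lt : (c x).-1 < j by have := cj x; have := dj y; lia.
  have /setP/(_ (x, y)) := congr1 (fun E : {ffun _ -> _} => E (Ordinal i_lt)) eqAB.
  rewrite !ffunE !inE /=.
  have -> : c x == (c x).-1.+1 by have := dj y; lia.
  have -> : d y == j - (c x).-1 by have := cj x; have := dj y; lia.
  have := A1 _ _ eq_cd; have := B1 _ _ eq_cd; have := ltn_ord (A x y); have := ltn_ord (B x y).
  by rewrite /=; lia.
rewrite -(card_in_imset ones_inj).
have -> : block_ones j c d @: G = [set E in family (fun i => mem (L i))].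
  apply/setP => E; rewrite inE; apply/imsetP/familyP => [[A /GP shA ->] i | EL].
    rewrite inE ffunE; apply/andP; split.
      by rewrite inE; apply/subsetP => -[x y]; rewrite !inE /= => /and3P[-> ->].
    apply/collinearP => -[x y] [x' y']; rewrite !inE /=.
    move=> /and3P[/eqP cx /eqP dy /eqP A1] /and3P[/eqP cx' /eqP dy' /eqP A1'].
    by apply: (shape_line shA) => //; rewrite ?cx ?dy ?cx' ?dy' //; have := ltn_ord i; lia.
  have memE i x y : (x, y) \in E i -> c x = i.+1 /\ d y = j - i.
    have := EL i; rewrite !inE => /andP[/subsetP sub _] /sub.
    by rewrite !inE => /andP[/eqP -> /eqP ->].
  have exE x y : [exists i : 'I_j, (x, y) \in E i] -> c x + d y = j.+1.
    by case/existsP => i /memE[-> ->]; have := ltn_ord i; lia.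
  have Bval x y : blocks_mx c d E x y = (if c x + d y <= j then 0
    else if [exists i : 'I_j, (x, y) \in E i] then 1 else 2) :> nat.
    by rewrite mxE; case: ifP => _; [|case: ifP => _]; rewrite inordK.
  have B1 x y : blocks_mx c d E x y = 1 :> nat -> exists i, (x, y) \in E i.
    by rewrite Bval; case: ifP => // _; case: ifP => // /existsP.
  exists (blocks_mx c d E); last first.
    apply/ffunP => i; rewrite ffunE; apply/setP => -[x y]; rewrite inE /=.
    apply/idP/and3P => [xyE | [/eqP cx _ /eqP/B1[i' xyE]]].
      have [cx dy] := memE _ _ _ xyE; rewrite cx dy !eqxx Bval.
      have ex : [exists i : 'I_j, (x, y) \in E i] by apply/existsP; exists i.
      by rewrite ex (exE _ _ ex) ltnn.
    have [cx' _] := memE _ _ _ xyE.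
    by rewrite (_ : i = i') //; apply/val_inj; move: cx'; rewrite cx => -[].
  apply/GP; split=> [x y le_cd | x y eq_cd | x y gt_cd | x x' y y' eq_cd cx' dy'].
  - by rewrite Bval le_cd.
  - by rewrite Bval eq_cd ltnn; case: ifP.
  - rewrite Bval leqNgt (ltnW gt_cd) /=; case: ifP => // /exE; lia.
  move=> /B1[i xyE] /B1[i' xyE'].
  have [cx _] := memE _ _ _ xyE; have [cx1 _] := memE _ _ _ xyE'.
  have eq_i : i' = i by apply/val_inj; move: cx'; rewrite cx cx1 => -[].
  rewrite eq_i in xyE'.
  have := EL i; rewrite inE => /andP[_ /collinearP colE].
  exact: (colE _ _ xyE xyE').
rewrite cardsE card_family foldrE big_map big_enum /=.
by apply: eq_bigr => i _; rewrite card_collinear.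
Qed.

(** * Class maps grouped by fibre sizes *)

Definition fibre_sizes m j (c : {ffun 'I_m -> 'I_j.+1}) : {ffun 'I_j.+1 -> 'I_m.+1} :=
  [ffun i => inord (\sum_x (c x == i))].

Lemma fibre_sizesE m j (c : {ffun 'I_m -> 'I_j.+1}) i :
  fibre_sizes c i = \sum_x (c x == i) :> nat.
Proof.
rewrite ffunE inordK // ltnS -[X in _ <= X]card_ord -sum1_card.
by apply: leq_sum => x _; case: eqP.
Qed.

(** Fibre sizes always add up to [m], so only the positivity condition of [inS] is at stake. *)
Lemma inS_fibre_sizesP m j (c : {ffun 'I_m -> 'I_j.+1}) :
  reflect (hits_all j (fun x => c x : nat)) (inS (fibre_sizes c)).
Proof.
have sum_sizes : \sum_i fibre_sizes c i == m.
  under eq_bigr => i _ do rewrite fibre_sizesE.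
  rewrite exchange_big /= -[X in _ == X]card_ord -sum1_card; apply/eqP.
  apply: eq_bigr => x _; rewrite (bigD1 (c x)) //= eqxx big1 // => i /negPf.
  by rewrite eq_sym => ->.
rewrite /inS sum_sizes; apply: (iffP forallP) => /= [pos k /andP[k_gt0 k_le] | hits i].
  have := pos (inord k); rewrite fibre_sizesE inordK // k_gt0 /=.
  rewrite lt0n sum_nat_eq0 negb_forall => /existsP[x].
  by rewrite eqb0 negbK => /eqP cx; exists x; rewrite cx inordK.
apply/implyP => i_gt0; have [x cx] : exists x, c x = i :> nat.
  by apply: hits; rewrite i_gt0 -ltnS /=.
rewrite fibre_sizesE (bigD1 x) //= (_ : c x == i) //.
exact/eqP/val_inj.
Qed.

Lemma card_fibre_sizes m j (v : {ffun 'I_j.+1 -> 'I_m.+1}) :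
  inS v -> #|[set c | fibre_sizes c == v]| = multinom v.
Proof.
case/andP => /eqP sum_v _; rewrite /multinom -(card_ffun_fibres sum_v) mulnK.
  apply: eq_card => c; rewrite !inE; apply/eqP/forallP => [<- i | eqv].
    by rewrite fibre_sizesE.
  by apply/ffunP => i; apply/val_inj; rewrite /= fibre_sizesE (eqP (eqv i)).
by rewrite prodn_gt0 // => i; exact: fact_gt0.
Qed.

(** This turns sums over class maps into the multinomial sums of the theorem. *)
Lemma sum_fibre_sizes m j (F : {ffun 'I_j.+1 -> 'I_m.+1} -> nat) :
  \sum_(c : {ffun 'I_m -> 'I_j.+1} | inS (fibre_sizes c)) F (fibre_sizes c) =
  \sum_(v | inS v) multinom v * F v.
Proof.
rewrite (partition_big (@fibre_sizes m j) (@inS m j)) //=; apply: eq_bigr => v Sv.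
rewrite -(card_fibre_sizes Sv) -sum1_card big_distrl /=; apply: eq_big => c.
  by rewrite inE andbC; case: eqP => // ->.
by case/andP => _ /eqP ->; rewrite mul1n.
Qed.

Lemma hits_all_le m j (c : 'I_m -> nat) : hits_all j c -> j <= m.
Proof.
move=> hits; have ex (i : 'I_j) : exists x, c x == i.+1.
  by have [|x cx] := hits i.+1; [rewrite ltn_ord | exists x; rewrite cx].
pose f i := xchoose (ex i); have fP i : c (f i) = i.+1 by apply/eqP; exact: (xchooseP (ex i)).
rewrite -[j]card_ord -[m]card_ord; apply: (leq_card f) => i i' eqf.
by apply/val_inj; have := fP i; rewrite eqf fP => -[].
Qed.

(** * Counting by the number of levels *)

Definition strong_lonesum_rank m n j := [set A : ternary_mx m n | strong_lonesum A & #|levels A| == j].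

Lemma card_strong_lonesum_rank m n j :
  #|strong_lonesum_rank m n j| =
  \sum_(c : {ffun 'I_m -> 'I_j.+1} | inS (fibre_sizes c))
    \sum_(d : {ffun 'I_n -> 'I_j.+1} | inS (fibre_sizes d))
      \prod_(1 <= i < j.+1) f3 (fibre_sizes c (inord i)) (fibre_sizes d (inord (j.+1 - i))).
Proof.
pose C (A : ternary_mx m n) : {ffun 'I_m -> 'I_j.+1} := [ffun x => inord (row_class A x)].
pose D (A : ternary_mx m n) : {ffun 'I_n -> 'I_j.+1} := [ffun y => inord (col_class A y)].
have CE A x : #|levels A| = j -> C A x = row_class A x :> nat.
  by move=> Aj; rewrite ffunE inordK // ltnS -Aj row_class_le.
have DE A y : #|levels A| = j -> D A y = col_class A y :> nat.
  by move=> Aj; rewrite ffunE inordK // ltnS -Aj col_class_le.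
have slP A : A \in strong_lonesum_rank m n j ->
    [/\ block_shape j (fun x => C A x) (fun y => D A y) A,
        inS (fibre_sizes (C A)) & inS (fibre_sizes (D A))].
  rewrite inE => /andP[/strong_lonesum_shape + /eqP Aj]; rewrite Aj.
  case=> [[s0 s1 s2 sl] hc hd]; split.
  - split=> [x y|x y|x y|x x' y y']; rewrite !CE // !DE //; auto; exact: sl.
  - by apply/inS_fibre_sizesP => k /hc[x cx]; exists x; rewrite CE.
  - by apply/inS_fibre_sizesP => k /hd[y dy]; exists y; rewrite DE.
rewrite -sum1_card (partition_big C (fun c => inS (fibre_sizes c))) /=; last first.
  by move=> A /slP[].
apply: eq_bigr => c /inS_fibre_sizesP hc.
rewrite (partition_big D (fun d => inS (fibre_sizes d))) /=; last first.
  by move=> A /andP[/slP[]].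
apply: eq_bigr => d /inS_fibre_sizesP hd.
(* [G] consists of exactly the matrices of block shape for [c] and [d]; the uniqueness in
   [stair_classes] shows that such a matrix has these classes and [j] levels. *)
pose G := [set A in strong_lonesum_rank m n j | (C A == c) && (D A == d)].
rewrite (eq_bigl (mem G)) => [|A]; last by rewrite /= in_setId andbA.
rewrite sum1_card (@card_block_shape m n j (fun x => c x) (fun y => d y)).
- rewrite big_add1 big_mkord /=; apply: eq_bigr => i _.
  rewrite subSS !fibre_sizesE; congr f3; rewrite -sum1_card big_mkcond /=; apply: eq_bigr => x _.
    by rewrite inE -val_eqE /= inordK ?ltnS //; case: eqP.
  by rewrite inE -val_eqE /= inordK ?ltnS ?leq_subr //; case: eqP.
- by move=> x; rewrite -ltnS.
- by move=> y; rewrite -ltnS.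
move=> A; rewrite in_setId; split=> [/andP[/slP[shA _ _] /andP[/eqP <- /eqP <-]] // | shA].
have stair x y : (j < c x + d y) = (0 < A x y).
  case: (ltngtP (c x + d y) j.+1) => cd.
  - by have /= := shape0 shA cd; lia.
  - by have /= := shape2 shA cd; lia.
  - by have /= := shape1 shA cd; lia.
have cj x : c x <= j by rewrite -ltnS.
have dj y : d y <= j by rewrite -ltnS.
have [Aj cA dA] := stair_classes cj dj hc hd stair.
rewrite inE (shape_strong_lonesum shA) Aj eqxx /=; apply/andP; split; apply/eqP/ffunP => z.
  by apply/val_inj; rewrite /= CE.
by apply/val_inj; rewrite /= DE.
Qed.

(** Only the zero matrix has no levels; it is the leading 1 of the formula. *)
Lemma card_strong_lonesum_rank0 m n : #|strong_lonesum_rank m n 0| = 1.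
Proof.
rewrite -[RHS](cards1 (const_mx ord0 : ternary_mx m n)); apply: eq_card => A.
rewrite !inE.
apply/andP/eqP => [[_ /eqP/cards0_eq lev0] | ->].
  apply/matrixP => x y; rewrite mxE; apply/val_inj/eqP => /=; apply: contraT; rewrite -lt0n.
  by move/row_supp_level; rewrite lev0 inE.
have sh : block_shape 0 (fun _ : 'I_m => 0) (fun _ : 'I_n => 0) (const_mx ord0).
  by split=> // x y; rewrite mxE.
split; first exact: shape_strong_lonesum sh.
rewrite cards_eq0; apply/eqP/setP => S; rewrite [RHS]inE; apply/negP.
rewrite 2!inE => /andP[/set0Pn[y yS] /imsetP[x _ defS]].
by move: yS; rewrite defS inE mxE.
Qed.

Theorem theorem3p5 (m n : nat) (hm : (1 <= m)%N) (hn : (1 <= n)%N) :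
  #|[set A : 'M['I_3]_(m, n) | strong_lonesum A]| =
  (1 + \sum_(1 <= j < (minn m n).+1)
         \sum_(mm : {ffun 'I_j.+1 -> 'I_m.+1} | inS mm)
         \sum_(nn : {ffun 'I_j.+1 -> 'I_n.+1} | inS nn)
           multinom mm * multinom nn *
           \prod_(1 <= i < j.+1) f3 (mm (inord i)) (nn (inord (j.+1 - i))))%N.
Proof.
have rank_le A : A \in [set A : 'M['I_3]_(m, n) | strong_lonesum A] ->
    #|levels A| < (minn m n).+1.
  rewrite inE => /strong_lonesum_shape[_ /hits_all_le lem /hits_all_le len].
  by rewrite ltnS leq_min lem len.
rewrite -[X in _ = X + _](card_strong_lonesum_rank0 m n) -sum1_card.
(* By [rank_le], [inord] does not alter the number of levels. *)
rewrite (partition_big (fun A => inord #|levels A| : 'I_(minn m n).+1) xpredT) //=.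
transitivity (\sum_(j < (minn m n).+1) #|strong_lonesum_rank m n j|).
  apply: eq_bigr => j _; rewrite -sum1_card; apply: eq_bigl => A.
  rewrite [RHS]inE -val_eqE /= [in LHS]inE; case: (boolP (strong_lonesum A)) => //= lA.
  by rewrite inordK // rank_le ?inE.
rewrite -(big_mkord xpredT (fun j => #|strong_lonesum_rank m n j|)) big_ltn //; congr (_ + _).
apply: eq_bigr => j _; rewrite card_strong_lonesum_rank.
rewrite (sum_fibre_sizes (fun v => \sum_(d : {ffun 'I_n -> 'I_j.+1} | inS (fibre_sizes d))
  \prod_(1 <= i < j.+1) f3 (v (inord i)) (fibre_sizes d (inord (j.+1 - i))))).
apply: eq_bigr => v _.
rewrite (sum_fibre_sizes (fun w => \prod_(1 <= i < j.+1) f3 (v (inord i)) (w (inord (j.+1 - i))))).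
by rewrite big_distrr /=; apply: eq_bigr => w _; rewrite mulnA.
Qed.
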